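(* Suppose that the standing assumptions (i)–(iii) of the context hold, that $\theta>\theta_{\min}$, that the safety sets are given by the affine system in the context, and that the constants $M_{ip},\overline\Delta_i$ satisfy the bounds in the context. If $c(z)$ is linear and $\mathcal Z$ is a bounded mixed-integer polyhedron, then the problem $$\min_{z\in\mathcal Z}\ c(z)\quad\text{s.t.}\quad\sup_{\mathbb P\in\mathcal P_{\theta,\varepsilon}(\mathcal N)}\mathbb P\left[Y\notin\mathcal S(z)\mid X\in\mathcal N\right]\le\epsilon$$ is equivalent (same feasible decisions $z$, after projection, and same objective) to the mixed-integer program $$\begin{aligned}\min\quad&c(z)\\ \text{s.t.}\quad&K_0+\epsilon\varepsilon t-\varepsilon\lambda-\tfrac1N\sum_{i\in[N]}v_i\ge\theta,\\&v_i+\lambda\ge s_i&&\forall i\in[N],\\&\delta_i+\bar\kappa_i\ge t-s_i&&\forall i\in[N],\\&0\le\delta_i\le\overline\Delta_i(1-\mathfrak z_i)&&\forall i\in[N],\\&\delta_i\le m_{ip}(z)+M_{ip}\mathfrak z_i&&\forall i\in[N],\ p\in[P],\\&s_i\ge-\bar\kappa_i,\quad v_i\ge0&&\forall i\in[N],\\&\lambda\le\epsilon t,\quad t\ge0,\quad\lambda\in\mathbb R,\quad s\in\mathbb R^N,\\&z\in\mathcal Z,\quad\delta\in\mathbb R_+^N,\quad\mathfrak z\in\{0,1\}^N.\end{aligned}$$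
   Context: $[N]=\{1,\dots,N\}$, $[a]_+=\max\{a,0\}$. Two distinct symbols are used: $\varepsilon\in(0,1]$ is a lower bound on the probability of the conditioning event, and $\epsilon\in(0,1)$ is the risk limit. $\mathcal X$ is the context space with metric $d_{\mathcal X}$; the outcome space is $\mathcal Y=\mathbb R^{\dim(y)}$ with $d_{\mathcal Y}$ induced by a norm $\|\cdot\|_{\mathcal Y}$, whose dual norm is $\|\cdot\|_{\mathcal Y,*}$; $X,Y$ denote the coordinates of $\mathcal X\times\mathcal Y$. Given samples $(\hat x_i,\hat y_i)$, $i\in[N]$, let $\widehat{\mathbb P}_N=\frac1N\sum_i\delta_{(\hat x_i,\hat y_i)}$. $W$ is the type-1 Wasserstein distance with ground metric $d_{\mathcal X}(x,x')+d_{\mathcal Y}(y,y')$. $x_0\in\mathcal X$ is a target context, $\gamma\ge0$, and $\mathcal N=\mathcal N_\gamma(x_0)\subseteq\mathcal X$ satisfies $x_0\in\mathcal N$, $\sup_{x\in\mathcal N}d_{\mathcal X}(x,x_0)\le\gamma$, $\mathcal N_0(x_0)=\{x_0\}$. With $\theta>0$ and $\mathbb P_X$ the $\mathcal X$-marginal, $\mathcal P_{\theta,\varepsilon}(\mathcal N)=\{\mathbb P: W(\mathbb P,\widehat{\mathbb P}_N)\le\theta,\ \mathbb P_X(\mathcal N)\ge\varepsilon\}$. Affine safety system: for known $a_p\in\mathbb R^{\dim(z)}$, $b_p\in\mathbb R^{\dim(y)}\setminus\{0\}$, $d_p\in\mathbb R$, $p\in[P]$ (which may depend on $x_0$), $$\mathcal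 S(z)=\{y: y^\top b_p+d_p-z^\top a_p>0\ \ \forall p\in[P]\},\qquad \mathcal S^c(z)=\mathcal Y\setminus\mathcal S(z).$$ Normalized margins: $m_{ip}(z)=\dfrac{\hat y_i^\top b_p+d_p-z^\top a_p}{\|b_p\|_{\mathcal Y,*}}$. The decision set $\mathcal Z\subseteq\mathbb R^{\dim(z)}$ is nonempty. Finite constants satisfy $M_{ip}\ge\max_{z\in\mathcal Z}[-m_{ip}(z)]_+$ and $\overline\Delta_i\ge\max_{z\in\mathcal Z}[\min_{p\in[P]}m_{ip}(z)]_+$. Standing assumptions: (i) $(\mathcal X,d_{\mathcal X})$, $(\mathcal Y,d_{\mathcal Y})$ are Polish metric spaces with Borel $\sigma$-fields, transport allowed on all of $\mathcal X\times\mathcal Y$; (ii) $\mathcal N$ is Borel and the distances from each $\hat x_i$ to $\mathcal N$ and $\mathcal N^c$ are finite; (iii) for every $z\in\mathcal Z$, $\mathcal S^c(z)$ is a nonempty Borel set at finite distance from each $\hat y_i$. Define $\kappa_i^{\rm in}=\inf_{x\in\mathcal N}d_{\mathcal X}(\hat x_i,x)$, $\kappa_i^{\rm out}=\inf_{x\in\mathcal N^c}d_{\mathcal X}(\hat x_i,x)$, $\bar\kappa_i=\kappa_i^{\rm in}-\kappa_i^{\rm out}$, $K_0=\frac1N\sum_i\kappa_i^{\rm out}$, and $\theta_{\min}=\inf\{W(\mathbb P,\widehat{\mathbb P}_N):\mathbb P_X(\mathcal N)\ge\varepsilon\}$. *)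

(* Defs.v *)
From HB Require Import structures.
From mathcomp Require Import all_boot all_order all_algebra.
From mathcomp Require Import all_classical all_reals all_analysis.

Set Implicit Arguments.
Unset Strict Implicit.
Unset Printing Implicit Defensive.

Import Order.TTheory GRing.Theory Num.Theory.
Import numFieldNormedType.Exports.

Local Open Scope classical_set_scope.
Local Open Scope ring_scope.

(** Complete metric spaces.  [Pointed] is there only because the measurable
    types of the library are pointed. *)
#[short(type="completeMetricType")]
HB.structure Definition CompleteMetric (R : numDomainType) :=
  { T of Complete T & Metric R T & Pointed T }.

Definition separable (T : topologicalType) : Prop :=
  exists2 D : set T, countable D & dense D.

Notation borel T := (g_sigma_algebraType (@open T)).

Section Norms.
Context {R : realType} {n : nat}.
Implicit Types (u v : 'cV[R]_n) (nrm : 'cV[R]_n -> R).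

Definition dot u v : R := (u^T *m v) ord0 ord0.

Definition is_norm nrm : Prop :=
  [/\ forall u v, nrm (u + v) <= nrm u + nrm v,
      forall (a : R) u, nrm (a *: u) = `|a| * nrm u &
      forall u, nrm u = 0 -> u = 0].

Definition norm_dist nrm u v : R := nrm (u - v).

Definition dual_norm nrm v : R := sup [set dot u v | u in [set u | nrm u <= 1]].

End Norms.

(** Extended-real valued because the distance to [set0] is [+oo]. *)
Definition set_dist {R : realType} {T : Type} (dist : T -> T -> R) (x : T)
    (A : set T) : \bar R :=
  ereal_inf [set (dist x y)%:E | y in A].

Section Empirical.
Local Open Scope ereal_scope.
Context {d : measure_display} {T : measurableType d} {R : realType} {N : nat}.
Variable xi : 'I_N -> T.

Definition empirical (A : set T) : \bar R :=
  (N%:R^-1)%:E * \sum_(i < N) \d_(xi i) A.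

Let empirical0 : empirical set0 = 0.
Proof. by rewrite /empirical big1 ?mule0// => i _; rewrite measure0. Qed.

Let empirical_ge0 A : 0 <= empirical A.
Proof.
by rewrite mule_ge0 ?lee_fin ?invr_ge0 ?ler0n//; apply: sume_ge0 => i _.
Qed.

Let empirical_semi_sigma_additive : semi_sigma_additive empirical.
Proof.
move=> F mF tF mUF; rewrite /empirical.
rewrite (_ : (fun n => _) = (fun n =>
    (N%:R^-1)%:E * \sum_(i < N) \sum_(0 <= k < n) (\d_(xi i) (F k) : \bar R))).
  apply: cvgeZl => //; apply: cvg_nnesum => [i _|i _].
    by apply: nearW => n; apply: sume_ge0.
  exact: measure_semi_sigma_additive.
apply/funext => n; rewrite exchange_big/= ge0_sume_distrr//.
by move=> k _; apply: sume_ge0.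
Qed.

HB.instance Definition _ := isMeasure.Build _ _ _ empirical
  empirical0 empirical_ge0 empirical_semi_sigma_additive.

End Empirical.

Section Wasserstein.
Local Open Scope ereal_scope.
Context {d : measure_display} {T : measurableType d} {R : realType}.

Definition coupling (mu nu : {measure set T -> \bar R}) :
    set (probability (T * T)%type R) :=
  [set pi | forall A, measurable A ->
    pushforward pi fst A = mu A /\ pushforward pi snd A = nu A].

Definition wasserstein1 (cost : T -> T -> R)
    (mu nu : {measure set T -> \bar R}) : \bar R :=
  ereal_inf [set \int[pi]_w (cost w.1 w.2)%:E | pi in coupling mu nu].

Definition cond_prob (P : probability T R) (A B : set T) : \bar R :=
  P (A `&` B) / P B.

End Wasserstein.

Section Ambiguity.
Context {R : realType} {X : completeMetricType R} {dy : nat}.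
Variable nrm : 'cV[R]_dy -> R.

(** All norms of [R^dy] are complete and induce the topology that the library
    puts on column vectors: for any norm [nrm] the space is Polish, and its
    Borel sets are those of [borel 'cV[R]_dy].
    The spaces being separable, the product sigma-algebra is the Borel
    sigma-algebra of the product. *)
Local Notation XY := (borel X * borel 'cV[R]_dy)%type.

Definition ground_cost (w w' : XY) : R :=
  @mdist R X w.1 w'.1 + norm_dist nrm w.2 w'.2.

Context {N : nat}.
Variables (xhat : 'I_N -> X) (yhat : 'I_N -> 'cV[R]_dy).

Definition samples (i : 'I_N) : XY := (xhat i, yhat i).

Definition wass_to_empirical (P : probability XY R) : \bar R :=
  wasserstein1 ground_cost P (empirical samples).

Variables (Nb : set X) (vareps : R).

Definition large_on_nbhd : set (probability XY R) :=
  [set P : probability XY R |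
    (vareps%:E <= pushforward P fst (Nb : set (borel X)))%E].

Definition theta_min : \bar R :=
  ereal_inf [set wass_to_empirical P | P in large_on_nbhd].

Definition ambiguity_set (theta : R) : set (probability XY R) :=
  [set P | (wass_to_empirical P <= theta%:E)%E /\ large_on_nbhd P].

Definition worst_case_risk (theta : R) (S : set 'cV[R]_dy) : \bar R :=
  ereal_sup [set cond_prob P [set w | ~ S w.2] [set w | Nb w.1]
            | P in ambiguity_set theta].

Definition kappa_in (i : 'I_N) : R := fine (set_dist (@mdist R X) (xhat i) Nb).

Definition kappa_out (i : 'I_N) : R :=
  fine (set_dist (@mdist R X) (xhat i) (~` Nb)).

Definition kappa_bar (i : 'I_N) : R := kappa_in i - kappa_out i.

Definition K0 : R := N%:R^-1 * \sum_(i < N) kappa_out i.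

End Ambiguity.

Definition context_nbhd {R : realType} {X : metricType R} (gamma : R) (x0 : X)
    (Nb : set X) : Prop :=
  [/\ Nb x0,
      (ereal_sup [set (mdist x x0)%:E | x in Nb] <= gamma%:E)%E &
      gamma = 0 -> Nb = [set x0]].

Section Safety.
Context {R : realType} {dy dz P : nat}.

Record affine_system := AffineSystem {
  asys_a : 'I_P -> 'cV[R]_dz;
  asys_b : 'I_P -> 'cV[R]_dy;
  asys_d : 'I_P -> R }.

Variable sys : affine_system.

Definition affine_value (y : 'cV[R]_dy) (p : 'I_P) (z : 'cV[R]_dz) : R :=
  dot y (asys_b sys p) + asys_d sys p - dot z (asys_a sys p).

Definition safety_set (z : 'cV[R]_dz) : set 'cV[R]_dy :=
  [set y | forall p, 0 < affine_value y p z].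

Definition margin (nrm : 'cV[R]_dy -> R) {N : nat} (yhat : 'I_N -> 'cV[R]_dy)
    (i : 'I_N) (p : 'I_P) (z : 'cV[R]_dz) : R :=
  affine_value (yhat i) p z / dual_norm nrm (asys_b sys p).

End Safety.

Arguments affine_system : clear implicits.

Definition pos_part {R : realType} (a : R) : R := Num.max a 0.

Definition mixed_integer_polyhedron {R : realType} {n : nat}
    (Z : set 'cV[R]_n) : Prop :=
  exists (m : nat) (A : 'M[R]_(m, n)) (b : 'cV[R]_m) (J : {set 'I_n}),
    Z = [set z | (forall i, (A *m z) i ord0 <= b i ord0) /\
                 (forall j, j \in J -> z j ord0 \is a Num.int)].

Record min_problem (R : realType) (V : Type) := MinProblem {
  feasible : set V;
  objective : V -> R }.

Definition equivalent_by {R : realType} {V W : Type} (proj : W -> V)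
    (p : min_problem R V) (q : min_problem R W) : Prop :=
  proj @` feasible q = feasible p /\
  (forall w, feasible q w -> objective q w = objective p (proj w)).

Section Problems.
Context {R : realType} {X : completeMetricType R} {dy dz N P : nat}.
Variables (nrm : 'cV[R]_dy -> R).
Variables (xhat : 'I_N -> X) (yhat : 'I_N -> 'cV[R]_dy) (Nb : set X).
Variables (theta vareps risk : R).
Variables (sys : affine_system R dy dz P).
Variables (Z : set 'cV[R]_dz) (c : 'cV[R]_dz -> R).

Definition chance_problem : min_problem R 'cV[R]_dz :=
  {| feasible := [set z | Z z /\
       (worst_case_risk nrm xhat yhat Nb vareps theta (safety_set sys z)
          <= risk%:E)%E];
     objective := c |}.

Record mip_point := MipPoint {
  mip_z : 'cV[R]_dz;
  mip_t : R;
  mip_lambda : R;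
  mip_s : 'I_N -> R;
  mip_v : 'I_N -> R;
  mip_delta : 'I_N -> R;
  mip_bin : 'I_N -> bool }.

Variables (M : 'I_N -> 'I_P -> R) (Delta : 'I_N -> R).

Let kbar := kappa_bar xhat Nb.
Let m := margin sys nrm yhat.

Definition mip_constraints (w : mip_point) : Prop :=
  let: MipPoint z t lambda s v delta bin := w in
  [/\ K0 xhat Nb + risk * vareps * t - vareps * lambda
        - N%:R^-1 * \sum_(i < N) v i >= theta,
      forall i, v i + lambda >= s i,
      forall i, delta i + kbar i >= t - s i,
      forall i, 0 <= delta i <= Delta i * (1 - (bin i)%:R) &
      forall i p, delta i <= m i p z + M i p * (bin i)%:R] /\
  [/\ forall i, s i >= - kbar i,
      forall i, v i >= 0,
      lambda <= risk * t,
      t >= 0 &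
      Z z].

Definition mip_problem : min_problem R mip_point :=
  {| feasible := mip_constraints; objective := c \o mip_z |}.

End Problems.

(* Main.v *)
Require Import Defs.
From HB Require Import structures.
From mathcomp Require Import all_boot all_order all_algebra.
From mathcomp Require Import all_classical all_reals all_analysis.
From mathcomp Require Import measurable_realfun.
From mathcomp Require Import ring lra.

Set Implicit Arguments.
Unset Strict Implicit.
Unset Printing Implicit Defensive.

Import Order.TTheory GRing.Theory Num.Theory.
Import numFieldNormedType.Exports.

(** Fix a decision [z].  It violates the chance constraint when some
    distribution within transport budget [theta] of the empirical one gives the
    neighbourhood [Nb] mass at least [vareps] and gives the unsafe outcomes a
    conditional mass above [risk].  Transport from an empirical measure
    decouples over the samples.  Only three destinations matter for a unit of
    mass at sample [i]: outside [Nb] at cost [kappa_out i], into [Nb] at cost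
    [kappa_in i], into [Nb] and onto an unsafe outcome at cost [kappa_in i]
    plus the distance [d i] of [yhat i] to the unsafe set.  The cheapest
    violation is therefore the value of a finite linear program in the masses
    sent to the last two destinations, and the mixed-integer program states
    that the dual of that linear program has a point of value at least [theta].
    The multiplier [t] prices unsafe mass, [risk * t - lambda >= 0] prices the
    mass constraint on [Nb], and [v i] prices the unit mass of sample [i].

    Weak duality ([wass_lagrangian]) shows that a dual point makes [z] feasible:
    integrating the dual inequalities against any coupling bounds the transport
    cost from below.  If [t > 0] a violation would cost more than [theta].  If
    [t = 0] the dual point says that every distribution with mass [vareps] on
    [Nb] costs at least [theta], which [theta > theta_min] excludes.

    Conversely, Farkas' lemma ([transport_lp_duality]) produces a dual point as
    soon as every primal plan costs at least [theta].  A plan cheaper than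
    [theta] may meet the risk constraint with equality and refers to distances
    that need not be attained, so it is first perturbed: a small share of the
    safe mass in [Nb] is made unsafe, which makes the violation strict, and the
    destinations are near-optimal.  The slack in the budget pays for both
    ([safe_multipliers]).

    The distance [d i] is the positive part of the least normalized margin,
    because the unsafe set is a finite union of half-spaces and the distance to
    a half-space is the margin divided by the dual norm of its normal vector.
    The dual norm is a genuine supremum since all norms of a finite-dimensional
    space are equivalent.  In the program, [delta i] ranges over [0, d i]: the
    binary variable switches between the margins, when all are nonnegative, and
    [0].

    The integral of a nonnegative function is the supremum of the integrals of
    the simple functions below it; the bounds on transport costs, on both sides,
    all come from comparisons with simple functions. *)

Local Open Scope classical_set_scope.
Local Open Scope ring_scope.

(** * Linear programming duality *)

Section farkas.
Context {R : realFieldType} {V : lmodType R}.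
Implicit Types f : V -> R.

Lemma scalar_fun0 f : scalar f -> f 0 = 0.
Proof.
move=> /(_ 1 0 0); rewrite scaler0 addr0 mul1r => /(canLR (addrK _)).
by rewrite subrr.
Qed.

Lemma scalar_funZ f k x : scalar f -> f (k *: x) = k * f x.
Proof.
by move=> lin_f; rewrite -[in LHS](addr0 (k *: x)) lin_f scalar_fun0// addr0.
Qed.

(** Induction on the number of functionals, after Bartl.  If dropping a
    functional [a j] breaks the implication, some [x0] satisfies the remaining
    constraints with [a j x0 = 1] and [c x0 > 0]; projecting along [x0] onto the
    kernel of [a j] brings the problem back to the remaining functionals. *)
Lemma farkas_seq (I : eqType) (r : seq I) (a : I -> V -> R) (c : V -> R) :
  uniq r -> (forall i, scalar (a i)) -> scalar c ->
  (forall x, (forall i, i \in r -> a i x <= 0) -> c x <= 0) ->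
  exists u : I -> R, (forall i, 0 <= u i) /\
    forall x, c x = \sum_(i <- r) u i * a i x.
Proof.
move=> + + lin_c; elim: r a c lin_c => [|j r IHr] a c lin_c.
  move=> _ _ c_le0; exists (fun=> 0); split=> // x; rewrite big_nil.
  apply/eqP; rewrite eq_le c_le0//=.
  have := c_le0 (- x); rewrite -scaleN1r scalar_funZ// mulN1r oppr_le0.
  exact.
move=> /andP[jr ur] lin_a c_le0.
have [c_le0_r|] := pselect
    (forall x, (forall i, i \in r -> a i x <= 0) -> c x <= 0).
  have [u [u0 cE]] := IHr _ _ lin_c ur lin_a c_le0_r.
  exists (fun i => if i == j then 0 else u i).
  split=> [i|x]; first by case: ifP.
  rewrite big_cons eqxx mul0r add0r cE; apply: eq_big_seq => i ir.
  by case: eqP => // ij; rewrite -ij ir in jr.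
move=> /existsNP[x1 /not_implyP[x1r /negP]]; rewrite -ltNge => cx1.
have ajx1 : 0 < a j x1.
  rewrite ltNge; apply: contraTN cx1 => ajx1; rewrite -leNgt; apply: c_le0 => i.
  by rewrite inE => /predU1P[->//|/x1r].
pose x0 := (a j x1)^-1 *: x1.
have ajx0 : a j x0 = 1 by rewrite scalar_funZ// mulVf ?gt_eqF.
have cx0 : 0 < c x0 by rewrite scalar_funZ// mulr_gt0 ?invr_gt0.
have x0r i : i \in r -> a i x0 <= 0.
  by move=> ir; rewrite scalar_funZ// pmulr_rle0 ?invr_gt0// x1r.
(* [corr f] is [f] composed with the projection along [x0] onto the kernel of
   [a j] *)
pose corr f x := f x - f x0 * a j x.
have corrE f x : scalar f -> corr f x = f (- a j x *: x0 + x).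
  by move=> lin_f; rewrite lin_f /corr; ring.
have lin_corr f : scalar f -> scalar (corr f).
  by move=> lin_f k x y; rewrite /corr lin_f lin_a; ring.
have := IHr (fun i => corr (a i)) (corr c) (lin_corr _ lin_c) ur
  (fun i => lin_corr _ (lin_a i)).
case=> [x xr|u [u0 cE]].
  rewrite corrE//; apply: c_le0 => i; rewrite inE => /predU1P[->|ir].
    by rewrite lin_a ajx0 mulr1 addNr.
  by rewrite -corrE// xr.
have cx0E : 0 <= c x0 - \sum_(i <- r) u i * a i x0.
  rewrite subr_ge0 (le_trans _ (ltW cx0))// big_seq sumr_le0// => i ir.
  by rewrite mulr_ge0_le0// x0r.
exists (fun i => if i == j then c x0 - \sum_(i <- r) u i * a i x0 else u i).
split=> [i|x]; first by case: ifP.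
have := cE x; rewrite big_cons eqxx {1}/corr => /(canRL (subrK _)) ->.
rewrite [in RHS]mulrBl addrC -[in RHS]addrA; congr (_ + _).
rewrite mulr_suml -sumrN -big_split/=; apply: eq_big_seq => i ir.
case: eqP => [ij|_]; first by rewrite -ij ir in jr.
by rewrite /corr; ring.
Qed.

Lemma farkas (I : finType) (a : I -> V -> R) (c : V -> R) :
  (forall i, scalar (a i)) -> scalar c ->
  (forall x, (forall i, a i x <= 0) -> c x <= 0) ->
  exists u : I -> R, (forall i, 0 <= u i) /\
    forall x, c x = \sum_i u i * a i x.
Proof.
move=> lin_a lin_c c_le0.
by apply: (farkas_seq (index_enum_uniq I)) => // x ax; apply: c_le0 => i;
  apply: ax; rewrite mem_index_enum.
Qed.

End farkas.

Definition avg {R : realFieldType} {N : nat} (f : 'I_N -> R) : R :=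
  N%:R^-1 * \sum_(i < N) f i.

Section avg.
Context {R : realFieldType} {N : nat}.
Implicit Types f g : 'I_N -> R.

Lemma avgD f g : avg (fun i => f i + g i) = avg f + avg g.
Proof. by rewrite /avg big_split/= mulrDr. Qed.

Lemma avgZ k f : avg (fun i => k * f i) = k * avg f.
Proof. by rewrite /avg -mulr_sumr mulrCA. Qed.

Lemma eq_avg f g : f =1 g -> avg f = avg g.
Proof. by move=> fg; rewrite /avg; congr (_ * _); apply: eq_bigr => i _. Qed.

Lemma avg_ge0 f : (forall i, 0 <= f i) -> 0 <= avg f.
Proof. by move=> f0; rewrite mulr_ge0 ?invr_ge0// sumr_ge0. Qed.

Lemma ler_avg f g : (forall i, f i <= g i) -> avg f <= avg g.
Proof. by move=> fg; rewrite ler_wpM2l ?invr_ge0// ler_sum. Qed.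

Lemma avg_cst (k : R) : (0 < N)%N -> avg (fun _ : 'I_N => k) = k.
Proof.
move=> N0; rewrite /avg sumr_const card_ord -[k *+ N]mulr_natl.
rewrite mulrA mulVf ?mul1r//.
by rewrite pnatr_eq0 -lt0n.
Qed.

Lemma scalar_avg (V : lmodType R) (f : 'I_N -> V -> R) :
  (forall i, scalar (f i)) -> scalar (fun x => avg (f^~ x)).
Proof.
by move=> lin_f k x y; rewrite -avgZ -avgD; apply: eq_avg => i; rewrite lin_f.
Qed.

Lemma avg_delta f i : avg (fun j => (j == i)%:R * f j) = f i / N%:R.
Proof.
rewrite /avg (bigD1 i)//= eqxx mul1r big1 ?addr0 1?mulrC// => j /negPf->.
by rewrite mul0r.
Qed.

End avg.

(** Strong duality for the linear program that moves the mass of sample [i]: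
    [p i] is the unsafe mass sent into the neighbourhood, [q i] the safe mass,
    [kap i] and [dist i] are the additional costs.  The program is made
    homogeneous by a scaling variable [tau], so that Farkas' lemma applies; the
    dual point is read off by evaluating the resulting identity of functionals
    at the unit vectors. *)
Lemma transport_lp_duality (R : realFieldType) (N : nat) (kap dist : 'I_N -> R)
    (K e rho theta : R) : (0 < N)%N ->
  (forall p q : 'I_N -> R,
    (forall i, 0 <= p i) -> (forall i, 0 <= q i) ->
    (forall i, p i + q i <= 1) ->
    e <= avg (fun i => p i + q i) ->
    rho * avg (fun i => p i + q i) <= avg p ->
    theta <= K + avg (fun i => p i * (kap i + dist i) + q i * kap i)) ->
  exists t mu (v : 'I_N -> R),
    [/\ 0 <= t, 0 <= mu, forall i, 0 <= v i &
     [/\ forall i, mu - rho * t + t <= v i + kap i + dist i,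
         forall i, mu - rho * t <= v i + kap i &
         theta <= K + e * mu - avg v]].
Proof.
move=> N0 primal.
have N0R : (N%:R : R) != 0 by rewrite pnatr_eq0 -lt0n.
pose V := ({ffun 'I_N -> R^o} * {ffun 'I_N -> R^o} * R^o)%type.
pose p i (x : V) : R := x.1.1 i.
pose q i (x : V) : R := x.1.2 i.
pose tau (x : V) : R := x.2.
have lin_p i : scalar (p i) by move=> k x y; rewrite /p /= !ffunE.
have lin_q i : scalar (q i) by move=> k x y; rewrite /q /= !ffunE.
have lin_tau : scalar tau by [].
have lin_pq i : scalar (fun x => p i x + q i x).
  by move=> k x y; rewrite lin_p lin_q; ring.
have lin_in := scalar_avg lin_pq.
have lin_unsafe := scalar_avg lin_p.
pose cost i x := p i x * (kap i + dist i) + q i x * kap i.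
have lin_cost i : scalar (cost i).
  by move=> k x y; rewrite /cost lin_p lin_q; ring.
have lin_avgcost := scalar_avg lin_cost.
pose a (k : 'I_N + 'I_N + 'I_N + 'I_3) (x : V) : R :=
  match k with
  | inl (inl (inl i)) => - p i x
  | inl (inl (inr i)) => - q i x
  | inl (inr i) => p i x + q i x - tau x
  | inr j => [:: - tau x;
                 e * tau x - avg (fun i => p i x + q i x);
                 rho * avg (fun i => p i x + q i x) - avg (p^~ x)]`_j
  end.
pose c x := (theta - K) * tau x - avg (cost^~ x).
have lin_a k : scalar (a k).
  case: k => [[[i|i]|i]|[[|[|[|j]]] hj]] k x y //=.
  - by rewrite lin_p; ring.
  - by rewrite lin_q; ring.
  - by rewrite lin_p lin_q -[_ *: _]/(_ * _) /tau; ring.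
  - by rewrite -[_ *: _]/(_ * _) /tau; ring.
  - by rewrite lin_in -[_ *: _]/(_ * _) /tau; ring.
  - by rewrite lin_in lin_unsafe; ring.
have lin_c : scalar c.
  by move=> k x y; rewrite /c lin_avgcost lin_tau; ring.
have [x ax|u [u0 cE]] := farkas lin_a lin_c.
  have p0 i : 0 <= p i x by rewrite -oppr_le0; exact: (ax (inl (inl (inl i)))).
  have q0 i : 0 <= q i x by rewrite -oppr_le0; exact: (ax (inl (inl (inr i)))).
  have pq i : p i x + q i x <= tau x.
    by rewrite -subr_le0; exact: (ax (inl (inr i))).
  have tau0 : 0 <= tau x by rewrite -oppr_le0; exact: (ax (inr ord0)).
  have ine : e * tau x <= avg (fun i => p i x + q i x).
    by rewrite -subr_le0; exact: (ax (inr (@Ordinal 3 1 isT))).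
  have risk : rho * avg (fun i => p i x + q i x) <= avg (p^~ x).
    by rewrite -subr_le0; exact: (ax (inr (@Ordinal 3 2 isT))).
  rewrite /c; move: tau0; rewrite le_eqVlt => /predU1P[tau0|tau0].
    (* a recession direction: the box constraints force [p = q = 0] *)
    rewrite -tau0 mulr0 sub0r oppr_le0 (_ : avg _ = 0)//.
    rewrite (_ : cost^~ x = fun=> 0) ?avg_cst//; apply/funext => i.
    have [pi0 qi0] : p i x = 0 /\ q i x = 0.
      by have := p0 i; have := q0 i; have := pq i; rewrite -tau0; lra.
    by rewrite /cost pi0 qi0; ring.
  pose k := (tau x)^-1; have k0 : 0 < k by rewrite invr_gt0.
  have ktau : k * tau x = 1 by rewrite mulVf ?gt_eqF.
  have pqE : avg (fun i => k * p i x + k * q i x)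
      = k * avg (fun i => p i x + q i x).
    by rewrite -avgZ; apply: eq_avg => i; ring.
  have := primal (fun i => k * p i x) (fun i => k * q i x).
  have -> : avg (fun i => k * p i x * (kap i + dist i) + k * q i x * kap i)
      = k * avg (cost^~ x).
    by rewrite -avgZ; apply: eq_avg => i; rewrite /cost; ring.
  rewrite pqE avgZ => H.
  rewrite subr_le0 -(ler_pM2l k0) mulrCA ktau mulr1 lerBlDl.
  apply: H => [i|i|i||]; rewrite ?mulr_ge0 ?(ltW k0)//.
  - by rewrite -mulrDr -ktau ler_pM2l.
  - by rewrite -[leLHS]mulr1 -ktau mulrCA ler_pM2l.
  - by rewrite mulrCA ler_pM2l.
have cE' x : c x =
    \sum_i u (inl (inl (inl i))) * - p i x
  + \sum_i u (inl (inl (inr i))) * - q i x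
  + \sum_i u (inl (inr i)) * (p i x + q i x - tau x)
  + (u (inr ord0) * - tau x
  + u (inr (@Ordinal 3 1 isT)) * (e * tau x - avg (fun i => p i x + q i x))
  + u (inr (@Ordinal 3 2 isT)) *
    (rho * avg (fun i => p i x + q i x) - avg (p^~ x))).
  rewrite cE !big_sumType/=; congr (_ + _).
  rewrite !big_ord_recr big_ord0/= add0r.
  by do !congr (_ + _); congr (u (inr _) * _); apply/val_inj.
pose mu := u (inr (@Ordinal 3 1 isT)).
pose t := u (inr (@Ordinal 3 2 isT)).
(* [avg] hides a factor [1 / N] that the multipliers of the box constraints
   do not have *)
pose v i := N%:R * u (inl (inr i)).
have sum_delta (w : 'I_N -> R) i : \sum_j w j * (j == i)%:R = w i.
  rewrite (bigD1 i)//= eqxx mulr1 big1 ?addr0// => j /negPf->.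
  by rewrite mulr0.
have avg_delta1 (i : 'I_N) : avg (fun j => (j == i)%:R) = N%:R^-1 :> R.
  rewrite -div1r -(@avg_delta R N (fun=> 1) i).
  by apply: eq_avg => j; rewrite mulr1.
exists t, mu, v; split; rewrite ?u0//; first by move=> i; rewrite mulr_ge0.
split=> [i|i|].
- pose x : V := ([ffun j => (j == i)%:R], 0, 0).
  have xp j : p j x = (j == i)%:R by rewrite /p ffunE.
  have xq j : q j x = 0 by rewrite /q ffunE.
  have xt : tau x = 0 by [].
  have := cE' x; rewrite /c xt.
  rewrite (eq_avg (f := cost^~ x)
    (g := fun j => (j == i)%:R * (kap j + dist j))); last first.
    by move=> j; rewrite /cost xp xq mul0r addr0.
  rewrite (eq_avg (f := p^~ x) (g := fun j => (j == i)%:R))//.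
  rewrite (eq_avg (f := fun j => p j x + q j x)
    (g := fun j => (j == i)%:R)); last first.
    by move=> j; rewrite xp xq addr0.
  rewrite avg_delta avg_delta1.
  rewrite -/mu -/t.
  have -> : \sum_j u (inl (inl (inl j))) * - p j x = - u (inl (inl (inl i))).
    rewrite -(sum_delta (fun j => u (inl (inl (inl j)))) i) -sumrN.
    by apply: eq_bigr => j _; rewrite xp mulrN.
  have -> : \sum_j u (inl (inl (inr j))) * - q j x = 0.
    by rewrite big1// => j _; rewrite xq oppr0 mulr0.
  have -> : \sum_j u (inl (inr j)) * (p j x + q j x - 0) = u (inl (inr i)).
    rewrite -(sum_delta (fun j => u (inl (inr j))) i).
    by apply: eq_bigr => j _; rewrite xp xq addr0 subr0.
  move=> E.
  have {}E : kap i + dist i = mu - rho * t + t - v i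
      + N%:R * u (inl (inl (inl i))).
    apply: (mulfI (invr_neq0 N0R)); rewrite mulrC.
    by have := E; rewrite /v; move=> /eqP; rewrite -subr_eq0 => /eqP E';
      apply/eqP; rewrite -subr_eq0 -oppr_eq0 -E'; apply/eqP; field.
  have : 0 <= N%:R * u (inl (inl (inl i))) by rewrite mulr_ge0.
  by move: E; lra.
- pose x : V := (0, [ffun j => (j == i)%:R], 0).
  have xq j : q j x = (j == i)%:R by rewrite /q ffunE.
  have xp j : p j x = 0 by rewrite /p ffunE.
  have xt : tau x = 0 by [].
  have := cE' x; rewrite /c xt.
  rewrite (eq_avg (f := cost^~ x)
    (g := fun j => (j == i)%:R * kap j)); last first.
    by move=> j; rewrite /cost xp xq mul0r add0r.
  rewrite (eq_avg (f := p^~ x) (g := fun j => 0))// avg_cst//.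
  rewrite (eq_avg (f := fun j => p j x + q j x)
    (g := fun j => (j == i)%:R)); last first.
    by move=> j; rewrite xp xq add0r.
  rewrite avg_delta avg_delta1.
  rewrite -/mu -/t.
  have -> : \sum_j u (inl (inl (inl j))) * - p j x = 0.
    by rewrite big1// => j _; rewrite xp oppr0 mulr0.
  have -> : \sum_j u (inl (inl (inr j))) * - q j x = - u (inl (inl (inr i))).
    rewrite -(sum_delta (fun j => u (inl (inl (inr j)))) i) -sumrN.
    by apply: eq_bigr => j _; rewrite xq mulrN.
  have -> : \sum_j u (inl (inr j)) * (p j x + q j x - 0) = u (inl (inr i)).
    rewrite -(sum_delta (fun j => u (inl (inr j))) i).
    by apply: eq_bigr => j _; rewrite xp xq add0r subr0.
  move=> E.
  have {}E : kap i = mu - rho * t - v i + N%:R * u (inl (inl (inr i))).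
    apply: (mulfI (invr_neq0 N0R)); rewrite mulrC.
    by have := E; rewrite /v; move=> /eqP; rewrite -subr_eq0 => /eqP E';
      apply/eqP; rewrite -subr_eq0 -oppr_eq0 -E'; apply/eqP; field.
  have : 0 <= N%:R * u (inl (inl (inr i))) by rewrite mulr_ge0.
  by move: E; lra.
- pose x : V := (0, 0, 1).
  have xq j : q j x = 0 by rewrite /q ffunE.
  have xp j : p j x = 0 by rewrite /p ffunE.
  have xt : tau x = 1 by [].
  have := cE' x; rewrite /c xt.
  rewrite (eq_avg (f := cost^~ x) (g := fun=> 0)); last first.
    by move=> j; rewrite /cost xp xq; ring.
  rewrite (eq_avg (f := p^~ x) (g := fun j => 0))// avg_cst//.
  rewrite (eq_avg (f := fun j => p j x + q j x) (g := fun=> 0)); last first.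
    by move=> j; rewrite xp xq addr0.
  rewrite avg_cst//.
  rewrite -/mu -/t.
  have -> : \sum_j u (inl (inl (inl j))) * - p j x = 0.
    by rewrite big1// => j _; rewrite xp oppr0 mulr0.
  have -> : \sum_j u (inl (inl (inr j))) * - q j x = 0.
    by rewrite big1// => j _; rewrite xq oppr0 mulr0.
  have -> : \sum_j u (inl (inr j)) * (p j x + q j x - 1) = - avg v.
    rewrite /avg -mulr_sumr mulrA mulVf// mul1r -sumrN.
    by apply: eq_bigr => j _; rewrite xp xq addr0 sub0r mulrN1.
  move=> E.
  by have := u0 (inr ord0); move: E; lra.
Qed.

(** * Integrals of nonnegative functions and discrete measures *)

Section lower_integral.
Local Open Scope ereal_scope.
Context d (T : measurableType d) (R : realType).
Import HBNNSimple.

Lemma integral_le_nnsfun (mu : {measure set T -> \bar R}) (f : T -> \bar R) M :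
  (forall x, 0 <= f x) ->
  (forall h : {nnsfun T >-> R}, (forall x, (h x)%:E <= f x) ->
    \int[mu]_x (h x)%:E <= M) ->
  \int[mu]_x f x <= M.
Proof.
move=> f0 H; rewrite ge0_integralTE//; apply/ge_ereal_sup => _ /= [h hf <-].
by rewrite -integralT_nnsfun; exact: H.
Qed.

Lemma integral_le_dominating (mu : {measure set T -> \bar R})
    (g f : T -> \bar R) :
  (forall x, 0 <= g x) -> (forall x, g x <= f x) ->
  \int[mu]_x g x <= \int[mu]_x f x.
Proof.
move=> g0 gf; have f0 x : 0 <= f x by exact: le_trans (gf x).
apply: integral_le_nnsfun => // h hg.
rewrite integralT_nnsfun (ge0_integralTE _ f0); apply: ereal_sup_ubound.
by exists h => // x; exact: le_trans (gf x).
Qed.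

(** A simple function, possibly of both signs, below a nonnegative function:
    its positive part is measurable and still lies below. *)
Lemma integral_simple_le (mu : probability T R) (I : finType) (c : I -> R)
    (E : I -> set T) (f : T -> R) :
  (forall i, measurable (E i)) -> (forall x, 0 <= f x)%R ->
  (forall x, \sum_i c i * \1_(E i) x <= f x)%R ->
  (\sum_i c i * fine (mu (E i)))%:E <= \int[mu]_x (f x)%:E.
Proof.
move=> mE f0 sf.
pose g i x := ((c i)%:E * (\1_(E i) x)%:E) : \bar R.
have int_1 i : mu.-integrable setT (fun x => (\1_(E i) x)%:E).
  exact: integrable_indic.
have int_g i : mu.-integrable setT (g i) by exact: integrableZl.
have int_sum : mu.-integrable setT (fun x => \sum_i g i x).
  by apply: integrable_sum.
have <- : \int[mu]_x (\sum_i g i x) = (\sum_i c i * fine (mu (E i)))%:E.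
  rewrite integral_sum// -sumEFin; apply: eq_bigr => i _.
  rewrite integralZl// integral_indic// setIT EFinM fineK//.
  exact: fin_num_measure.
apply: (@le_trans _ _ (\int[mu]_x (fun x => \sum_i g i x)^\+ x)).
  apply: le_integral => //; first exact: integrable_funepos.
  by move=> x _; rewrite funeposE le_max lexx.
apply: integral_le_dominating => x; first exact: funepos_ge0.
rewrite funeposE ge_max lee_fin f0 andbT.
apply: (@le_trans _ _ (\sum_i c i * \1_(E i) x)%:E); last by rewrite lee_fin.
by rewrite -sumEFin.
Qed.

(** For a nonnegative measurable function the integral is equal to the sum.  The
    bound for an arbitrary nonnegative function passes through the simple
    functions below it, whence an inequality only. *)
Lemma discrete_measure (s : seq (R * T)) :
  (forall k, k \in s -> 0 <= k.1)%R ->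
  exists mu : {measure set T -> \bar R},
    (forall A, mu A = \sum_(k <- s) k.1%:E * \d_(k.2) A) /\
    (forall f : T -> \bar R, (forall x, 0 <= f x) ->
      \int[mu]_x f x <= \sum_(k <- s) k.1%:E * f k.2).
Proof.
move=> s0.
suff [mu [muE muf]] : exists mu : {measure set T -> \bar R},
    (forall A, mu A = \sum_(k <- s) k.1%:E * \d_(k.2) A) /\
    (forall h : {nnsfun T >-> R},
      \int[mu]_x (h x)%:E = \sum_(k <- s) k.1%:E * (h k.2)%:E).
  exists mu; split=> // f f0; apply: integral_le_nnsfun => // h hf.
  rewrite muf big_seq [leRHS]big_seq; apply: lee_sum => k ks.
  by rewrite lee_wpmul2l// lee_fin s0.
elim: s s0 => [|[w x] s IHs] s0.
  exists mzero; split=> [A|h]; rewrite big_nil//.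
  exact: integral_measure_zero.
have [k ks|mu [muE muf]] := IHs; first by rewrite s0// inE ks orbT.
have w0 : (0 <= w)%R by apply: (s0 (w, x)); rewrite inE eqxx.
exists (measure_add (mscale (NngNum w0) \d_x) mu); split=> [A|h].
  by rewrite big_cons -muE; exact: measure_addE.
have h0 x' : setT x' -> 0 <= (h x')%:E by move=> _; rewrite lee_fin.
rewrite ge0_integral_measure_add//; last exact/measurable_EFinP.
rewrite big_cons muf ge0_integral_mscale//; last exact/measurable_EFinP.
rewrite integral_dirac//; last exact/measurable_EFinP.
by rewrite diracT mul1e.
Qed.

Lemma probability_of_measure (mu : {measure set T -> \bar R}) :
  mu setT = 1 -> exists P : probability T R, forall A, P A = mu A.
Proof.
move=> mu1; exists (mnormalize mu \d_point) => A /=.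
by rewrite /mnormalize mu1 onee_eq0 /= invr1 mule1.
Qed.

Lemma discrete_probability (I : finType) (w : I -> R) (a : I -> T) :
  (forall i, 0 <= w i)%R -> (\sum_i w i = 1)%R ->
  exists mu : probability T R,
    (forall A, mu A = (\sum_i w i * \1_A (a i))%:E) /\
    (forall f : T -> R, (forall x, 0 <= f x)%R ->
      \int[mu]_x (f x)%:E <= (\sum_i w i * f (a i))%:E).
Proof.
move=> w0 w1.
have s0 k : k \in [seq (w i, a i) | i <- index_enum I] -> (0 <= k.1)%R.
  by move=> /mapP[i _ ->] /=; exact: w0.
have [mu [muE muf]] := discrete_measure s0.
have {}muE A : mu A = (\sum_i w i * \1_A (a i))%:E.
  by rewrite muE big_map -sumEFin.
have mu1 : mu setT = 1.
  rewrite muE -[RHS]/(1%R%:E) -w1; congr EFin; apply: eq_bigr => i _.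
  by rewrite indicT mulr1.
have [P PE] := probability_of_measure mu1.
exists P; split=> [A|f f0]; first by rewrite PE.
rewrite (@eq_measure_integral _ _ _ _ mu); last by move=> A _ _; exact: PE.
apply: le_trans (muf (fun x => (f x)%:E) _) _.
  by move=> x; rewrite lee_fin.
by rewrite big_map -sumEFin.
Qed.

End lower_integral.

(** * Optimal transport from an empirical measure *)

Lemma measurable_fst_preimage d1 d2 (T1 : measurableType d1)
    (T2 : measurableType d2) (A : set T1) :
  measurable A -> measurable (fst @^-1` A : set (T1 * T2)).
Proof.
by move=> mA; rewrite -[X in measurable X]setTI; exact: measurable_fst.
Qed.

Lemma measurable_snd_preimage d1 d2 (T1 : measurableType d1)
    (T2 : measurableType d2) (A : set T2) :
  measurable A -> measurable (snd @^-1` A : set (T1 * T2)).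
Proof.
by move=> mA; rewrite -[X in measurable X]setTI; exact: measurable_snd.
Qed.

Section wasserstein_empirical.
Context {R : realType} d {T : measurableType d} {N : nat}.
Variables (cost : T -> T -> R) (xi : 'I_N -> T).
Hypotheses (N0 : (0 < N)%N) (cost_ge0 : forall w w', 0 <= cost w w').

Lemma empiricalE (A : set T) :
  (empirical xi : {measure set T -> \bar R}) A
  = (avg (fun i => \1_A (xi i)))%:E.
Proof. by rewrite /empirical /avg EFinM -sumEFin. Qed.

(** Weak duality.  The left-hand sides of the pointwise inequalities are
    collected into one simple function on pairs of points, below the cost; its
    integral against a coupling depends on the marginals only.  Samples may
    coincide, so [h i] is divided by the number of samples located at [xi i];
    off the samples, a null set, the constant [- (|a| + |b|)] brings the simple
    function below [0]. *)
Lemma wasserstein_empirical_ge (P : probability T R) (A B : set T)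
    (h : 'I_N -> R) (a b : R) :
  (forall i, measurable [set xi i]) -> measurable A -> measurable B ->
  (forall i w, h i + a * \1_A w + b * \1_B w <= cost w (xi i)) ->
  ((avg h + a * fine (P A) + b * fine (P B))%:E
     <= wasserstein1 cost P (empirical xi))%E.
Proof.
move=> mxi mA mB hcost; apply: le_ereal_inf_tmp => _ [pi /= coupling_pi <-].
pose same i j : R := \1_[set xi i] (xi j).
pose mult i := \sum_j same i j.
have same_xi i j : xi i = xi j -> same i =1 same j.
  by move=> ij k; rewrite /same ij.
have mult_gt0 i : 0 < mult i.
  rewrite /mult (bigD1 i)//= ltr_pwDl//.
    by rewrite /same indicE mem_set.
  by apply: sumr_ge0.
pose E (k : 'I_N + 'I_3) : set (T * T) :=
  match k with
  | inl i => snd @^-1` [set xi i]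
  | inr j => nth set0 [:: fst @^-1` A; fst @^-1` B; snd @^-1` (~` range xi)] j
  end.
pose c (k : 'I_N + 'I_3) : R :=
  match k with
  | inl i => h i / mult i
  | inr j => [:: a; b; - (`|a| + `|b|)]`_j
  end.
have mrange : measurable (~` range xi).
  apply: measurableC.
  have -> : range xi = \bigcup_(i in [set: 'I_N]) [set xi i].
    apply/seteqP; split=> [_ [i _ <-]|_ [i _ ->]]; by exists i.
  by apply: fin_bigcup_measurable => //; exact: finite_finset.
have mE k : measurable (E k).
  by case: k => [i|[[|[|[|j]]] hj]] //=;
    first [exact: measurable_fst_preimage|exact: measurable_snd_preimage].
have piE k : fine (pi (E k)) = match k with
  | inl i => mult i / N%:R
  | inr j => [:: fine (P A); fine (P B); 0]`_j
  end.
  case: k => [i|[[|[|[|j]]] hj]] //=.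
  - have [_] := coupling_pi _ (mxi i); rewrite /pushforward => ->.
    by rewrite empiricalE /= /avg mulrC.
  - by have [+ _] := coupling_pi _ mA; rewrite /pushforward => <-.
  - by have [+ _] := coupling_pi _ mB; rewrite /pushforward => <-.
  - have [_] := coupling_pi _ mrange; rewrite /pushforward => ->.
    rewrite empiricalE /= (eq_avg (g := fun=> 0)) ?avg_cst// => i.
    by rewrite indicE memNset//=; apply; exists i.
rewrite (_ : _ + _ + _ = \sum_k c k * fine (pi (E k))); last first.
  under [RHS]eq_bigr do rewrite piE.
  rewrite big_sumType/= !big_ord_recr big_ord0/= mulr0 addr0 add0r addrA.
  congr (_ + _ + _); rewrite /avg mulr_sumr; apply: eq_bigr => i _.
  by field; rewrite !gt_eqF// ltr0n.
apply: integral_simple_le => // -[w1 w2].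
rewrite big_sumType/= !big_ord_recr big_ord0/= add0r.
have -> : \1_(fst @^-1` A) (w1, w2) = \1_A w1 :> R by [].
have -> : \1_(fst @^-1` B) (w1, w2) = \1_B w1 :> R by [].
have -> : \1_(snd @^-1` (~` range xi)) (w1, w2) = \1_(~` range xi) w2 :> R.
  by [].
have [[j _ jw2]|Nw2] := pselect (range xi w2); last first.
  rewrite big1 ?add0r; last first.
    move=> i _; rewrite indicE memNset ?mulr0//= => w2E; apply: Nw2.
    by exists i.
  have -> : \1_(~` range xi) w2 = 1 :> R by rewrite indicE mem_set.
  rewrite mulr1.
  apply: le_trans (cost_ge0 _ _).
  have le_ind (r : R) (D : set T) : r * \1_D w1 <= `|r|.
    rewrite indicE; case: (_ \in _); rewrite ?mulr1 ?mulr0 ?normr_ge0//.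
    exact: ler_norm.
  by have := le_ind a A; have := le_ind b B; lra.
have -> : \1_(~` range xi) w2 = 0 :> R.
  by rewrite indicE memNset// => /(_ _); apply; exists j.
rewrite mulr0 addr0 -jw2.
(* at an atom, the first sum is an average of the [h i] over the samples
   located there *)
have le_sum_h :
    \sum_(i < N) h i / mult i * \1_(snd @^-1` [set xi i]) (w1, xi j)
    <= \sum_(i < N) (cost w1 (xi j) - a * \1_A w1 - b * \1_B w1)
         * (same j i / mult j).
  apply: ler_sum => i _.
  have -> : \1_(snd @^-1` [set xi i]) (w1, xi j) = same i j by [].
  have [ij|ij] := pselect (xi i = xi j); last first.
    have -> : same i j = 0 by rewrite /same indicE memNset//= => /esym.
    have -> : same j i = 0 by rewrite /same indicE memNset.
    by rewrite mul0r !mulr0.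
  have -> : mult i = mult j by apply: eq_bigr => k _; exact: same_xi.
  have same1 k l : xi k = xi l -> same k l = 1.
    by move=> kl; rewrite /same indicE mem_set.
  rewrite !same1// mulr1 div1r ler_pM2r ?invr_gt0//.
  by have := hcost i w1; rewrite ij; lra.
have sum_same : \sum_(i < N) same j i / mult j = 1.
  by rewrite -mulr_suml -/(mult j) mulfV ?gt_eqF.
move: le_sum_h; rewrite -mulr_sumr sum_same mulr1.
by move=> le_sum_h; rewrite addrA; lra.
Qed.

(** The coupling is the discrete measure with mass [w i j / N] at the pair
    [(a i j, xi i)]. *)
Lemma wasserstein_empirical_le (J : finType) (w : 'I_N -> J -> R)
    (a : 'I_N -> J -> T) :
  (forall i j, 0 <= w i j) -> (forall i, \sum_j w i j = 1) ->
  exists P : probability T R,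
    (forall A, P A = (avg (fun i => \sum_j w i j * \1_A (a i j)))%:E) /\
    (wasserstein1 cost P (empirical xi)
       <= (avg (fun i => \sum_j w i j * cost (a i j) (xi i)))%:E)%E.
Proof.
move=> w0 w1.
pose wN (k : 'I_N * J) := N%:R^-1 * w k.1 k.2.
have sumE (F : 'I_N -> J -> R) :
    \sum_k wN k * F k.1 k.2 = avg (fun i => \sum_j w i j * F i j).
  rewrite -(pair_bigA _ (fun i j => wN (i, j) * F i j))/= /avg mulr_sumr.
  apply: eq_bigr => i _; rewrite mulr_sumr.
  by apply: eq_bigr => j _; rewrite mulrA.
have wN0 k : 0 <= wN k by rewrite mulr_ge0 ?invr_ge0.
have wN1 : \sum_k wN k = 1.
  have := sumE (fun _ _ => 1); under eq_bigr do rewrite mulr1.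
  by move=> ->; rewrite (eq_avg (g := fun=> 1)) ?avg_cst// => i;
    under eq_bigr do rewrite mulr1.
have [P [PE _]] := discrete_probability (fun k => a k.1 k.2) wN0 wN1.
have [pi [piE int_pi]] :=
  discrete_probability (fun k => (a k.1 k.2, xi k.1)) wN0 wN1.
exists P; split=> [A|].
  by rewrite PE (sumE (fun i j => \1_A (a i j))).
apply: le_trans (_ : (\int[pi]_w (cost w.1 w.2)%:E <= _)%E).
  apply: ereal_inf_lbound; exists pi => // A mA; split.
    by rewrite /pushforward piE; exact/esym/PE.
  rewrite /pushforward piE empiricalE (sumE (fun i _ => \1_A (xi i))).
  congr EFin; apply: eq_avg => i.
  by rewrite -mulr_suml w1 mul1r.
rewrite (le_trans (int_pi (fun w => cost w.1 w.2) _))//.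
by rewrite (sumE (fun i j => cost (a i j) (xi i))).
Qed.

End wasserstein_empirical.

(** * Norms and dual norms of column vectors *)

Section dot.
Context {R : realType} {n : nat}.
Implicit Types u v b : 'cV[R]_n.

Lemma dotE u v : dot u v = \sum_i u i ord0 * v i ord0.
Proof. by rewrite /dot mxE; apply: eq_bigr => i _; rewrite mxE. Qed.

Lemma dotDl u v b : dot (u + v) b = dot u b + dot v b.
Proof. by rewrite /dot linearD mulmxDl mxE. Qed.

Lemma dotZl (a : R) u b : dot (a *: u) b = a * dot u b.
Proof. by rewrite /dot linearZ -scalemxAl mxE. Qed.

Lemma dotNl u b : dot (- u) b = - dot u b.
Proof. by rewrite -scaleN1r dotZl mulN1r. Qed.

Lemma dot_self_gt0 b : b != 0 -> 0 < dot b b.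
Proof.
move=> b0; have /existsNP[i bi] : ~ forall i, b i ord0 = 0.
  move=> b00; case/eqP: b0; apply/matrixP => i j.
  by rewrite (ord1 j) b00 mxE.
rewrite dotE (bigD1 i)//= ltr_wpDr//.
  by apply: sumr_ge0 => j _; rewrite -expr2 sqr_ge0.
by rewrite -expr2 exprn_even_gt0//=; apply/eqP.
Qed.

End dot.

Section norms.
Context {R : realType} {n : nat} (nrm : 'cV[R]_n -> R).
Hypothesis nrmP : is_norm nrm.
Implicit Types u v b : 'cV[R]_n.

Let nrmD u v : nrm (u + v) <= nrm u + nrm v. Proof. by case: nrmP. Qed.
Let nrmZ (a : R) u : nrm (a *: u) = `|a| * nrm u. Proof. by case: nrmP. Qed.

Lemma is_norm_eq0 u : nrm u = 0 -> u = 0.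
Proof. by case: nrmP => _ _; apply. Qed.

Lemma is_norm0 : nrm 0 = 0.
Proof. by rewrite -(scale0r 0) nrmZ normr0 mul0r. Qed.

Lemma is_normN u : nrm (- u) = nrm u.
Proof. by rewrite -scaleN1r nrmZ normrN1 mul1r. Qed.

Lemma is_norm_ge0 u : 0 <= nrm u.
Proof.
have := nrmD u (- u); rewrite subrr is_norm0 is_normN -mulr2n.
by rewrite pmulrn_lge0.
Qed.

Lemma is_norm_dist_ge0 u v : 0 <= norm_dist nrm u v.
Proof. exact: is_norm_ge0. Qed.

Lemma is_norm_sum (I : finType) (f : I -> 'cV[R]_n) :
  nrm (\sum_i f i) <= \sum_i nrm (f i).
Proof.
elim/big_ind2 : _ => //; first by rewrite is_norm0.
by move=> x y x' y' xy xy'; rewrite (le_trans (nrmD _ _))// lerD.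
Qed.

Lemma norm_le_mx_norm : exists2 C, 0 <= C & forall u, nrm u <= C * `|u|.
Proof.
exists (\sum_(i < n) nrm (delta_mx i ord0)).
  by apply: sumr_ge0 => i _; exact: is_norm_ge0.
move=> u; rewrite {1}(matrix_sum_delta u).
rewrite (le_trans (is_norm_sum _))// mulr_suml ler_sum// => i _.
rewrite big_ord1 nrmZ mulrC ler_wpM2l ?is_norm_ge0//.
have := @le_bigmax _ _ _ 0 (fun ij : 'I_n * 'I_1 => `|u ij.1 ij.2|) (i, ord0).
by rewrite /= -mx_normrE.
Qed.

Lemma is_norm_continuous : continuous nrm.
Proof.
have [C C0 nrmC] := norm_le_mx_norm.
move=> u; apply/(@cvgrPdist_lt _ _ _ _ (nbhs_filter u)) => e e0.
have C1 : 0 < C + 1 by rewrite ltr_wpDl.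
apply/(@nbhs_normP R _ u).
exists (e / (C + 1)) => [|v /=]; first by rewrite /= divr_gt0.
rewrite ltr_pdivlMr// => uv.
have dist_le : `|nrm u - nrm v| <= nrm (u - v).
  rewrite ler_norml; apply/andP; split.
    have := nrmD (v - u) u; rewrite subrK -(is_normN (v - u)) opprB; lra.
  by have := nrmD (u - v) v; rewrite subrK; lra.
rewrite (le_lt_trans dist_le)// (le_lt_trans (nrmC _))//.
by rewrite (le_lt_trans _ uv)// mulrC ler_wpM2l// lerDl.
Qed.

(** The norm attains a positive minimum on the unit sphere of the sup-norm, which
    is compact.  The sphere is taken in the row vectors and transposed. *)
Lemma mx_norm_le_norm : exists2 k, 0 < k & forall u, k * `|u| <= nrm u.
Proof.
have [n0|n0] := posnP n.
  exists 1 => // u; rewrite (_ : u = 0) ?normr0 ?mulr0 ?is_norm_ge0//.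
  by apply/matrixP => i; have := leq_trans (ltn_ord i) (eq_leq n0); rewrite ltn0.
pose S := [set x : 'rV[R]_n | `|x| = 1].
have normT (x : 'rV[R]_n) : `|x^T| = `|x|.
  apply/eqP; rewrite eq_le; apply/andP; split; rewrite [leLHS]mx_normrE.
    apply: bigmax_le => //= -[i j] _; rewrite /= mxE.
    have := @le_bigmax _ _ _ 0 (fun ij : 'I_1 * 'I_n => `|x ij.1 ij.2|) (j, i).
    by rewrite /= -mx_normrE.
  apply: bigmax_le => //= -[i j] _; rewrite /= -[x]trmxK mxE trmxK.
  have := @le_bigmax _ _ _ 0 (fun ij : 'I_n * 'I_1 => `|x^T ij.1 ij.2|) (j, i).
  by rewrite /= -mx_normrE.
have Scpt : compact S.
  apply: bounded_closed_compact.
    by exists 1; split=> // M M1 x /= ->; exact: ltW.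
  rewrite (_ : S = (fun x : 'rV[R]_n => `|x|) @^-1` [set 1]); last by [].
  apply: closed_comp => [x _|]; last exact: closed_eq.
  exact: norm_continuous.
have Sn0 : S !=set0.
  pose x : 'rV[R]_n := const_mx 1; exists x.
  rewrite /S /=; apply/eqP; rewrite eq_le; apply/andP; split.
    rewrite [leLHS]mx_normrE; apply: bigmax_le => //= ij _.
    by rewrite mxE normr1.
  have := @le_bigmax _ _ _ 0 (fun ij : 'I_1 * 'I_n => `|x ij.1 ij.2|)
    (ord0, Ordinal n0).
  by rewrite -mx_normrE /= mxE normr1.
have nrmT_cont : continuous (fun x : 'rV[R]_n => nrm x^T).
  move=> x; apply: continuous_comp; last exact: is_norm_continuous.
  apply/(@cvgrPdist_lt _ _ _ _ (nbhs_filter x)) => e e0.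
  apply/(@nbhs_normP R _ x); exists e => // y /=.
  by rewrite -linearB/= normT.
have [x /set_mem Sx xmin] := compact_EVT_min Sn0 Scpt
  (continuous_subspaceT nrmT_cont).
have nx0 : 0 < nrm x^T.
  rewrite lt_neqAle is_norm_ge0 andbT; apply/eqP => /esym/is_norm_eq0 xT0.
  by move: Sx; rewrite /S /= -normT xT0 normr0 => /esym/eqP; rewrite oner_eq0.
exists (nrm x^T) => // u.
have [->|u0] := eqVneq u 0; first by rewrite normr0 mulr0 is_norm_ge0.
have u0' : 0 < `|u| by rewrite normr_gt0.
have /(xmin _) : `|u|^-1 *: u^T \in S.
  apply/mem_set; rewrite /S /= normrZ normfV normr_id -normT trmxK.
  by rewrite mulVf// gt_eqF.
rewrite linearZ/= trmxK nrmZ normfV normr_id.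
by rewrite ler_pdivlMl// mulrC.
Qed.

(** The set of which [dual_norm] is the supremum is bounded; otherwise the dual
    norm would be the default value [0] of [sup]. *)
Lemma dot_bounded b : has_ubound [set dot u b | u in [set u | nrm u <= 1]].
Proof.
have [k k0 nrmk] := mx_norm_le_norm.
exists (\sum_i k^-1 * `|b i ord0|) => _ [u /= u1 <-].
rewrite dotE ler_sum// => i _; rewrite (le_trans (ler_norm _))// normrM.
rewrite ler_wpM2r// -[leRHS]mulr1 -ler_pdivrMl ?invr_gt0// invrK.
apply: le_trans u1; apply: le_trans (nrmk u); rewrite ler_wpM2l//; first exact: ltW.
have := @le_bigmax _ _ _ 0 (fun ij : 'I_n * 'I_1 => `|u ij.1 ij.2|) (i, ord0).
by rewrite /= -mx_normrE.
Qed.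

Lemma dot_le_dual_norm u b : dot u b <= nrm u * dual_norm nrm b.
Proof.
have [u0|u0] := eqVneq (nrm u) 0.
  by rewrite (is_norm_eq0 u0) is_norm0 mul0r -(scale0r 0) dotZl mul0r.
have {}u0 : 0 < nrm u by rewrite lt_neqAle eq_sym u0 is_norm_ge0.
rewrite -ler_pdivrMl// -dotZl; apply: ub_le_sup (dot_bounded b) _ _.
exists ((nrm u)^-1 *: u) => //=.
by rewrite nrmZ normfV (gtr0_norm u0) mulVf// gt_eqF.
Qed.

Lemma dual_norm_gt0 b : b != 0 -> 0 < dual_norm nrm b.
Proof.
move=> b0; have := dot_le_dual_norm b b; have := dot_self_gt0 b0.
by move=> bb /(lt_le_trans bb); rewrite pmulr_rgt0// lt_neqAle is_norm_ge0 andbT;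
  apply: contra b0 => /eqP/esym/is_norm_eq0 ->.
Qed.

Lemma dual_norm_dir b r : 0 <= r -> r < dual_norm nrm b ->
  exists2 u, nrm u <= 1 & r < dot u b.
Proof.
move=> r0 /sup_gt[|_ [u /= u1 <-] ru]; last by exists u.
by exists (dot 0 b); exists 0 => //=; rewrite is_norm0.
Qed.

End norms.

(** * Distances to a set, and to the complement of a polyhedron *)

Section set_dist.
Context {R : realType} {T : Type} (dist : T -> T -> R) (x : T) (A : set T).
Hypothesis fin_dist : set_dist dist x A \is a fin_num.

Lemma set_dist_le y : A y -> fine (set_dist dist x A) <= dist x y.
Proof.
by move=> Ay; rewrite -lee_fin fineK//; apply: ereal_inf_lbound; exists y.
Qed.

Lemma set_dist_near e : 0 < e ->
  exists2 y, A y & dist x y <= fine (set_dist dist x A) + e.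
Proof.
move=> e0; have [_ [y Ay <-]] := lb_ereal_inf_adherent e0 fin_dist.
rewrite -/(set_dist dist x A) -[X in (_ < X + _)%E -> _]fineK// -EFinD lte_fin.
by move=> /ltW; exists y.
Qed.

End set_dist.

Lemma borel_set1 (T : ptopologicalType) (x : T) :
  hausdorff_space T -> measurable ([set x] : set (borel T)).
Proof.
move=> hT; rewrite -[X in measurable X]setCK; apply: measurableC.
apply: sub_sigma_algebra => /=; rewrite openC.
exact/accessible_closed_set1/hausdorff_accessible.
Qed.

Lemma fin_inf_attained (R : realType) (I : finType) (f : I -> R) (i0 : I) :
  exists2 i, inf (range f) = f i & forall j, f i <= f j.
Proof.
case: (@arg_minP _ _ I i0 xpredT f isT) => i _ imin.
have {}imin j : f i <= f j by exact: imin.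
exists i => //; apply/eqP; rewrite eq_le; apply/andP; split.
  by apply: ge_inf; [exists (f i) => _ [j _ <-]|exists i].
by apply: lb_le_inf; [exists (f i); exists i|move=> _ [j _ <-]].
Qed.

Section affine.
Context {R : realType} {dy dz P N : nat} (nrm : 'cV[R]_dy -> R).
Variables (sys : affine_system R dy dz P) (yhat : 'I_N -> 'cV[R]_dy).
Hypotheses (nrmP : is_norm nrm) (b_neq0 : forall p, asys_b sys p != 0).

Lemma affine_valueD y u p z :
  affine_value sys (y + u) p z = affine_value sys y p z + dot u (asys_b sys p).
Proof. by rewrite /affine_value dotDl; ring. Qed.

(** One half-space contains [y]; moving from [yhat i] to [y] removes the value of
    its affine form, which the dual norm bounds. *)
Lemma margin_le_unsafe i z y : ~ safety_set sys z y ->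
  exists p, margin sys nrm yhat i p z <= norm_dist nrm y (yhat i).
Proof.
move=> /existsNP[p /negP]; rewrite -leNgt => yp; exists p.
rewrite /margin ler_pdivrMr ?dual_norm_gt0// /norm_dist.
have := affine_valueD y (yhat i - y) p z; rewrite addrCA subrr addr0 => ->.
rewrite -(is_normN nrmP) opprB.
by have := dot_le_dual_norm nrmP (yhat i - y) (asys_b sys p); lra.
Qed.

(** Conversely the margin is nearly reached, along a direction that nearly attains
    the dual norm of the normal vector. *)
Lemma unsafe_near_margin i p z e : 0 < e -> exists2 y,
  ~ safety_set sys z y &
  norm_dist nrm y (yhat i) <= pos_part (margin sys nrm yhat i p z) + e.
Proof.
move=> e0; set m := margin _ _ _ _ _ _; set val := affine_value sys (yhat i) p z.
have db0 := dual_norm_gt0 nrmP (b_neq0 p).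
have valE : val = m * dual_norm nrm (asys_b sys p).
  by rewrite /m /margin divfK// gt_eqF.
rewrite /pos_part; have [m0|m0] := leP m 0.
  exists (yhat i); last by rewrite /norm_dist subrr is_norm0// add0r ltW.
  by move=> /(_ p); rewrite -/val valE pmulr_lgt0// ltNge m0.
have me0 : 0 < m + e by rewrite addr_gt0.
have [||u u1 udir] := @dual_norm_dir _ _ _ nrmP (asys_b sys p) (val / (m + e)).
- by rewrite valE; apply: divr_ge0; [apply: mulr_ge0|]; exact: ltW.
- by rewrite ltr_pdivrMr// valE mulrC ltr_pM2l// ltrDl.
exists (yhat i - (m + e) *: u).
  move=> /(_ p); rewrite affine_valueD dotNl dotZl -/val.
  by move: udir; rewrite ltr_pdivrMr// mulrC; lra.
rewrite /norm_dist addrAC subrr add0r is_normN//.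
have [_ nrmZ _] := nrmP; rewrite nrmZ gtr0_norm//.
by rewrite ger_pMr.
Qed.

End affine.

(** * Duality for the chance constraint *)

Section reformulation.
Context {R : realType} {X : completeMetricType R} {dy dz N P : nat}.
Variables (nrm : 'cV[R]_dy -> R).
Variables (xhat : 'I_N -> X) (yhat : 'I_N -> 'cV[R]_dy) (Nb : set X).
Variables (theta vareps risk : R).
Variables (sys : affine_system R dy dz P) (z : 'cV[R]_dz).
Local Notation XY := (borel X * borel 'cV[R]_dy)%type.
Hypotheses (N_gt0 : (0 < N)%N) (vareps_gt0 : 0 < vareps)
  (nrmP : is_norm nrm)
  (b_neq0 : forall p, asys_b sys p != 0)
  (Nb_borel : measurable (Nb : set (borel X)))
  (Nb_dist : forall i, set_dist (@mdist R X) (xhat i) Nb \is a fin_num)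
  (NbC_dist : forall i, set_dist (@mdist R X) (xhat i) (~` Nb) \is a fin_num)
  (unsafe_neq0 : ~` safety_set sys z !=set0)
  (unsafe_borel : measurable (~` safety_set sys z : set (borel 'cV[R]_dy))).

Let inN : set XY := [set w | Nb w.1].
Let unsafe : set XY := [set w | ~ safety_set sys z w.2].
Let cost := @ground_cost R X dy nrm.
Let kout := kappa_out xhat Nb.
Let kbar := kappa_bar xhat Nb.

Let minN : measurable inN.
Proof. exact: measurable_fst_preimage. Qed.

Let munsafe : measurable unsafe.
Proof. exact: measurable_snd_preimage unsafe_borel. Qed.

Let mU : measurable (unsafe `&` inN). Proof. exact: measurableI. Qed.

Let cost_ge0 w w' : 0 <= cost w w'.
Proof. by rewrite addr_ge0 ?mdist_ge0// is_norm_dist_ge0. Qed.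

Lemma worst_case_riskP :
  (worst_case_risk nrm xhat yhat Nb vareps theta (safety_set sys z)
    <= risk%:E)%E <->
  (forall Q : probability XY R, ambiguity_set nrm xhat yhat Nb vareps theta Q ->
    fine (Q (unsafe `&` inN)) <= risk * fine (Q inN)).
Proof.
have frac (Q : probability XY R) : large_on_nbhd Nb vareps Q ->
    (cond_prob Q unsafe inN <= risk%:E)%E =
    (fine (Q (unsafe `&` inN)) <= risk * fine (Q inN)).
  rewrite /large_on_nbhd /= /pushforward -/inN => eQ.
  have Q0 : 0 < fine (Q inN).
    by rewrite (lt_le_trans vareps_gt0)// -lee_fin fineK// fin_num_measure.
  rewrite /cond_prob -[Q inN]fineK ?fin_num_measure//.
  rewrite -[Q (_ `&` _)]fineK ?fin_num_measure// inver gt_eqF// -EFinM lee_fin.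
  by rewrite ler_pdivrMr.
split=> [risk_le Q [WQ eQ]|H].
  rewrite -frac//; apply: le_trans risk_le; apply: ereal_sup_ubound.
  by exists Q.
by apply: ge_ereal_sup => _ [Q [WQ eQ] <-]; rewrite frac//; exact: H.
Qed.

(** Lagrangian bound: [t] prices the unsafe mass in [Nb], [- lam] the mass of
    [Nb], and [v i] the unit mass of sample [i]. *)
Lemma wass_lagrangian (Q : probability XY R) (t lam : R) (v delta : 'I_N -> R) :
  (forall i, 0 <= v i) ->
  (forall i, - kbar i <= v i + lam) ->
  (forall i, t <= v i + lam + delta i + kbar i) ->
  (forall i y, ~ safety_set sys z y -> delta i <= norm_dist nrm y (yhat i)) ->
  ((K0 xhat Nb - avg v + t * fine (Q (unsafe `&` inN)) - lam * fine (Q inN))%:E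
    <= wass_to_empirical nrm xhat yhat Q)%E.
Proof.
move=> v0 v_stay v_unsafe delta_le.
have msample i : measurable [set samples xhat yhat i].
  rewrite (_ : [set _] = [set xhat i] `*` [set yhat i]); last first.
    by apply/seteqP; split=> [_ ->//|[x y] [/= -> ->]].
  apply: measurableX; apply: borel_set1; first exact: metric_hausdorff.
  exact: norm_hausdorff.
have := @wasserstein_empirical_ge R _ XY N cost (samples xhat yhat) N_gt0
  cost_ge0 Q _ _ (fun i => kout i - v i) t (- lam) msample mU minN.
rewrite (_ : avg _ = K0 xhat Nb - avg v) ?mulNr; last first.
  have -> : K0 xhat Nb = avg kout by [].
  rewrite -[- avg v]mulN1r -avgZ -avgD.
  by apply: eq_avg => i; rewrite mulN1r.
apply=> i [x y].
have kbarE : kbar i = kappa_in xhat Nb i - kout i by [].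
have nrm0 := is_norm_dist_ge0 nrmP y (yhat i).
rewrite /cost /ground_cost /= metric_sym.
have [xN|xN] := pselect (Nb x); last first.
  have -> : \1_inN (x, y) = 0 :> R by rewrite indicE memNset.
  have -> : \1_(unsafe `&` inN) (x, y) = 0 :> R.
    by rewrite indicE memNset// => -[].
  have : kout i <= mdist (xhat i) x by exact: set_dist_le.
  by have := v0 i; move: nrm0; lra.
have -> : \1_inN (x, y) = 1 :> R by rewrite indicE mem_set.
have : kappa_in xhat Nb i <= mdist (xhat i) x by exact: set_dist_le.
have [yS|yS] := pselect (safety_set sys z y).
  have -> : \1_(unsafe `&` inN) (x, y) = 0 :> R.
    by rewrite indicE memNset// => -[].
  by have := v_stay i; move: nrm0 kbarE; lra.
have -> : \1_(unsafe `&` inN) (x, y) = 1 :> R by rewrite indicE mem_set.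
by have := v_unsafe i; have := delta_le i y yS; move: kbarE; lra.
Qed.

Let unsafe_dist i :=
  pos_part (inf (range (fun p => margin sys nrm yhat i p z))).

(** The distances need not be attained, whence the error [2 * e].  The unsafe mass
    may exceed the average of [p], since the outcome of a sample that is merely
    moved into [Nb] may itself be unsafe. *)
Lemma wass_transport_plan (p q : 'I_N -> R) (e : R) :
  (forall i, 0 <= p i) -> (forall i, 0 <= q i) ->
  (forall i, p i + q i <= 1) -> 0 < e ->
  exists Q : probability XY R,
    [/\ fine (Q inN) = avg (fun i => p i + q i),
        avg p <= fine (Q (unsafe `&` inN)) &
        (wass_to_empirical nrm xhat yhat Q <=
         (K0 xhat Nb
          + avg (fun i => p i * (kbar i + unsafe_dist i) + q i * kbar i)
          + 2 * e)%:E)%E].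
Proof.
move=> p0 q0 pq1 e0.
have /choice[xin xinP] : forall i, exists x,
    Nb x /\ mdist (xhat i) x <= kappa_in xhat Nb i + e.
  by move=> i; have [x Nx xd] := set_dist_near (Nb_dist i) e0; exists x.
have /choice[xout xoutP] : forall i, exists x,
    ~ Nb x /\ mdist (xhat i) x <= kout i + e.
  by move=> i; have [x Nx xd] := set_dist_near (NbC_dist i) e0; exists x.
have /choice[ybad ybadP] : forall i, exists y,
    ~ safety_set sys z y /\ norm_dist nrm y (yhat i) <= unsafe_dist i + e.
  move=> i; have [_ /existsNP[k0 _]] := unsafe_neq0.
  have [k kE _] := fin_inf_attained (fun k => margin sys nrm yhat i k z) k0.
  have [y yS yd] := unsafe_near_margin yhat nrmP b_neq0 i k z e0.
  by exists y; rewrite /unsafe_dist kE.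
pose w i (j : 'I_3) := [:: p i; q i; 1 - p i - q i]`_j.
pose a i (j : 'I_3) : XY :=
  nth (samples xhat yhat i)
    [:: (xin i, ybad i); (xin i, yhat i); (xout i, yhat i)] j.
have sum3 (F : 'I_3 -> R) :
    \sum_j F j = F ord0 + F (@Ordinal 3 1 isT) + F (@Ordinal 3 2 isT).
  rewrite !big_ord_recr big_ord0/= add0r.
  by do !congr (_ + _); congr F; apply/val_inj.
have w0 i j : 0 <= w i j.
  case: j => [[|[|[|j]]] hj] //=; rewrite /w/= ?p0 ?q0//.
  by have := pq1 i; lra.
have w1 i : \sum_j w i j = 1 by rewrite sum3 /w/=; ring.
have [Q [QE WQ]] := wasserstein_empirical_le (cost := cost)
  (samples xhat yhat) N_gt0 cost_ge0 a w0 w1.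
have in_xin y i : \1_inN (xin i, y) = 1 :> R.
  by rewrite indicE mem_set//; exact: (xinP i).1.
have in_xout y i : \1_inN (xout i, y) = 0 :> R.
  by rewrite indicE memNset//; exact: (xoutP i).1.
exists Q; split.
- rewrite QE /=; apply: eq_avg => i.
  by rewrite sum3 /w /a /= !in_xin in_xout; ring.
- rewrite QE /=; apply: ler_avg => i.
  rewrite sum3 /w /a /=.
  have -> : \1_(unsafe `&` inN) (xin i, ybad i) = 1 :> R.
    by rewrite indicE mem_set//; split; [exact: (ybadP i).1|exact: (xinP i).1].
  have -> : \1_(unsafe `&` inN) (xout i, yhat i) = 0 :> R.
    by rewrite indicE memNset// => -[_]; exact: (xoutP i).1.
  by rewrite mulr1 mulr0 addr0 lerDl mulr_ge0.
- apply: le_trans WQ _; rewrite lee_fin.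
  have -> : K0 xhat Nb = avg kout by [].
  rewrite -[2 * e](avg_cst _ N_gt0) -!avgD; apply: ler_avg => i.
  rewrite sum3 /w /a /= /cost /ground_cost /= !(metric_sym _ (xhat i)).
  have dyy : norm_dist nrm (yhat i) (yhat i) = 0.
    by rewrite /norm_dist subrr is_norm0.
  rewrite dyy !addr0.
  have kbarE : kbar i = kappa_in xhat Nb i - kout i by [].
  have [_ dxin] := xinP i; have [_ dxout] := xoutP i; have [_ dy'] := ybadP i.
  have r0 : 0 <= 1 - p i - q i by have := pq1 i; lra.
  have dp := ler_wpM2l (p0 i) (lerD dxin dy').
  have dq := ler_wpM2l (q0 i) dxin.
  have dr := ler_wpM2l r0 dxout.
  have pe : p i * e <= e.
    by rewrite ger_pMl//; have := q0 i; have := pq1 i; lra.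
  by move: dp dq dr pe; rewrite kbarE; lra.
Qed.

(** By duality it is enough that no plan costs less than [theta].  From a cheaper
    plan [(p, q)], moving a share [h] of the safe mass to the unsafe one makes
    the violation strict: the excess of unsafe mass is affine in [h],
    nonnegative at [h = 0] and equal to [(1 - risk) * (avg p + avg q)] at
    [h = 1]. *)
Lemma safe_multipliers :
  (forall Q : probability XY R, ambiguity_set nrm xhat yhat Nb vareps theta Q ->
    fine (Q (unsafe `&` inN)) <= risk * fine (Q inN)) -> risk < 1 ->
  exists t mu (v : 'I_N -> R),
    [/\ 0 <= t, 0 <= mu, forall i, 0 <= v i &
     [/\ forall i, mu - risk * t + t <= v i + kbar i + unsafe_dist i,
         forall i, mu - risk * t <= v i + kbar i &
         theta <= K0 xhat Nb + vareps * mu - avg v]].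
Proof.
move=> safe risk1; apply: transport_lp_duality => // p q p0 q0 pq1 epq rpq.
rewrite leNgt; apply/negP.
set c0 := _ + avg _ => c0_lt.
pose D := avg (fun i => q i * unsafe_dist i).
have D0 : 0 <= D.
  by apply: avg_ge0 => i; rewrite mulr_ge0// le_max lexx orbT.
pose g := (theta - c0) / 2; have g0 : 0 < g by rewrite divr_gt0// subr_gt0.
(* [h <= 1] and [h * D <= g], including when [D = 0] *)
pose h := g / (g + D); have gD0 : 0 < g + D by rewrite ltr_wpDr.
have h0 : 0 < h by rewrite divr_gt0.
have h1 : h <= 1 by rewrite ler_pdivrMr// mul1r lerDl.
have hD : h * D <= g.
  by rewrite /h mulrAC ler_pdivrMr// ler_pM2l// lerDr ltW.
have e0 : 0 < g / 2 by rewrite divr_gt0.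
have [||||Q [Qin Qun WQ]] :=
  @wass_transport_plan (fun i => p i + h * q i) (fun i => (1 - h) * q i)
    (g / 2).
- by move=> i; rewrite addr_ge0// mulr_ge0// ltW.
- by move=> i; rewrite mulr_ge0// subr_ge0.
- by move=> i; have := pq1 i; lra.
- exact: e0.
have inE : avg (fun i => p i + h * q i + (1 - h) * q i)
    = avg (fun i => p i + q i) by apply: eq_avg => i; ring.
have costE : avg (fun i => (p i + h * q i) * (kbar i + unsafe_dist i) +
    (1 - h) * q i * kbar i)
    = avg (fun i => p i * (kbar i + unsafe_dist i) + q i * kbar i) + h * D.
  by rewrite -avgZ -avgD; apply: eq_avg => i; ring.
have ambQ : ambiguity_set nrm xhat yhat Nb vareps theta Q.
  split.
    apply: le_trans WQ _; rewrite lee_fin costE.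
    by move: hD c0_lt; rewrite /g /c0; lra.
  rewrite /large_on_nbhd /= /pushforward -/inN.
  by rewrite -[Q inN]fineK ?fin_num_measure// lee_fin Qin inE.
have := safe Q ambQ; rewrite Qin inE => safeQ.
move: Qun; rewrite avgD avgZ => Qun.
have pq0 : 0 < (1 - risk) * (avg p + avg q).
  by rewrite mulr_gt0 ?subr_gt0// -avgD (lt_le_trans vareps_gt0).
move: rpq safeQ; rewrite avgD => rpq safeQ.
have : h * ((1 - risk) * (avg p + avg q)) <= 0.
  have : 0 <= (1 - h) * (avg p - risk * (avg p + avg q)).
    by rewrite mulr_ge0// subr_ge0.
  by move: Qun safeQ; lra.
by rewrite pmulr_rle0// leNgt pq0.
Qed.

End reformulation.

Theorem theorem3
  (R : realType) (X : completeMetricType R) (dy dz N P : nat)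
  (nrm : 'cV[R]_dy -> R)
  (xhat : 'I_N -> X) (yhat : 'I_N -> 'cV[R]_dy)
  (gamma : R) (x0 : X) (Nb : set X)
  (theta vareps risk : R)
  (sys : affine_system R dy dz P)
  (Z : set 'cV[R]_dz) (c : {scalar 'cV[R]_dz})
  (M : 'I_N -> 'I_P -> R) (Delta : 'I_N -> R)
  (N_gt0 : (0 < N)%N)
  (vareps_itv : 0 < vareps <= 1)
  (risk_itv : 0 < risk < 1)
  (nrm_norm : is_norm nrm)
  (gamma_ge0 : 0 <= gamma)
  (Nb_nbhd : context_nbhd gamma x0 Nb)
  (theta_gt0 : 0 < theta)
  (b_neq0 : forall p, asys_b sys p != 0)
  (Z_neq0 : Z !=set0)
  (* (i) *)
  (X_separable : separable X)
  (* (ii) *)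
  (Nb_borel : measurable (Nb : set (borel X)))
  (Nb_dist : forall i, set_dist (@mdist R X) (xhat i) Nb \is a fin_num)
  (NbC_dist : forall i, set_dist (@mdist R X) (xhat i) (~` Nb) \is a fin_num)
  (* (iii) *)
  (unsafe_neq0 : forall z, Z z -> ~` safety_set sys z !=set0)
  (unsafe_borel : forall z, Z z ->
     measurable (~` safety_set sys z : set (borel 'cV[R]_dy)))
  (unsafe_dist : forall z i, Z z ->
     set_dist (norm_dist nrm) (yhat i) (~` safety_set sys z) \is a fin_num)
  (theta_gt : (theta_min nrm xhat yhat Nb vareps < theta%:E)%E)
  (M_bound : forall i p,
     ubound [set pos_part (- margin sys nrm yhat i p z) | z in Z] (M i p))
  (Delta_bound : forall i,
     ubound [set pos_part (inf (range (fun p => margin sys nrm yhat i p z)))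
            | z in Z] (Delta i))
  (Z_bounded : bounded_set Z)
  (Z_mip : mixed_integer_polyhedron Z) :
  equivalent_by (@mip_z R dz N)
    (chance_problem nrm xhat yhat Nb theta vareps risk sys Z c)
    (mip_problem nrm xhat yhat Nb theta vareps risk sys Z c M Delta).
Proof.
have [vareps0 _] := andP vareps_itv; have [risk0 risk1] := andP risk_itv.
have margin_min z i : Z z -> exists2 p,
    inf (range (fun p => margin sys nrm yhat i p z))
      = margin sys nrm yhat i p z &
    forall p', margin sys nrm yhat i p z <= margin sys nrm yhat i p' z.
  move=> /unsafe_neq0[y /existsNP[p0 _]].
  exact: (fin_inf_attained (fun p => margin sys nrm yhat i p z) p0).
split; last by move=> [z t lam s v delta bin].
apply/seteqP; split=> [_ [[z t lam s v delta bin] + <-]|z] /=.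
- move=> [[budget v_s delta_s delta_Delta delta_M] [s_kbar v0 lam_t t0 Zz]].
  rewrite -/(avg v) in budget.
  split=> //.
  have riskP := worst_case_riskP nrm xhat yhat theta risk vareps0 Nb_borel
    (unsafe_borel _ Zz).
  apply: riskP.2 => Q [WQ eQ].
  have delta_le i y :
      ~ safety_set sys z y -> delta i <= norm_dist nrm y (yhat i).
    move=> /(margin_le_unsafe yhat nrm_norm b_neq0 i)[p mp].
    have := delta_M i p; have := delta_Delta i.
    have := is_norm_dist_ge0 nrm_norm y (yhat i).
    case: (bin i); rewrite /= ?subrr ?mulr0 ?addr0 => nrm0 /andP[_ delta_le0].
      by move=> _; exact: le_trans nrm0.
    by move=> delta_m; exact: le_trans mp.
  have lagr (Q' : probability (borel X * borel 'cV[R]_dy)%type R) :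
      ((K0 xhat Nb - avg v
      + t * fine (Q' ([set w | ~ safety_set sys z w.2] `&` [set w | Nb w.1]))
      - lam * fine (Q' [set w | Nb w.1]))%:E
      <= wass_to_empirical nrm xhat yhat Q')%E.
    apply: (wass_lagrangian N_gt0 nrm_norm Nb_borel Nb_dist NbC_dist
      (unsafe_borel _ Zz) Q' v0 _ _ delta_le) => i.
      exact: le_trans (s_kbar i) (v_s i).
    by have := v_s i; have := delta_s i; lra.
  have mass_ge (Q' : probability (borel X * borel 'cV[R]_dy)%type R) :
      large_on_nbhd Nb vareps Q' ->
      vareps * (risk * t - lam)
        <= fine (Q' [set w | Nb w.1]) * (risk * t - lam).
    rewrite /large_on_nbhd /= => eQ'; rewrite ler_wpM2r ?subr_ge0//.
    rewrite -lee_fin fineK// fin_num_measure//; exact: measurable_fst_preimage.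
  move: t0; rewrite le_eqVlt => /predU1P[t0|t0].
    (* the budget constraint now bounds below the cost of every distribution
       with mass [vareps] on [Nb] *)
    have [_ [Q' eQ' <-]] := ereal_inf_lt theta_gt.
    move=> /(le_lt_trans (lagr Q')); rewrite lte_fin.
    by have := mass_ge _ eQ'; move: budget; rewrite -t0; lra.
  have := le_trans (lagr Q) WQ; rewrite lee_fin => lagrQ.
  rewrite -(ler_pM2l t0).
  by have := mass_ge _ eQ; move: budget lagrQ; lra.
- move=> [Zz].
  have riskP := worst_case_riskP nrm xhat yhat theta risk vareps0 Nb_borel
    (unsafe_borel _ Zz).
  move=> /riskP.1 safe.
  have [t [mu [v [t0 mu0 v0 [v_unsafe v_stay budget]]]]] :=
    safe_multipliers N_gt0 vareps0 nrm_norm b_neq0 Nb_borel Nb_dist NbC_dist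
      (unsafe_neq0 _ Zz) safe risk1.
  pose worst i := inf (range (fun p => margin sys nrm yhat i p z)).
  (* [mu = risk * t - lambda] prices the mass of [Nb] *)
  exists (MipPoint z t (risk * t - mu) (fun i => v i + (risk * t - mu)) v
    (fun i => pos_part (worst i)) (fun i => worst i <= 0)) => //=.
  rewrite -/(avg v).
  split; split=> //.
  + by move: budget; lra.
  + by move=> i; have := v_unsafe i; rewrite -/(worst i); lra.
  + move=> i; rewrite le_max lexx orbT /=.
    have : pos_part (worst i) <= Delta i by apply: Delta_bound; exists z.
    rewrite /pos_part; case: (leP (worst i) 0) => [_ _|_].
      by rewrite /= subrr mulr0.
    by rewrite /= subr0 mulr1.
  + move=> i p; have [p0 worstE worst_le] := margin_min z i Zz.
    have : pos_part (- margin sys nrm yhat i p z) <= M i p.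
      by apply: M_bound; exists z.
    rewrite /pos_part ge_max => /andP[mM _]; have := worst_le p.
    rewrite -worstE -/(worst i).
    case: (leP (worst i) 0) => [_ _|_]; rewrite /= ?mulr1 ?mulr0.
      by move: mM; lra.
    by rewrite addr0.
  + by move=> i; have := v_stay i; lra.
  + by rewrite gerBl.
Qed.
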